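(* For Lebesgue-almost every pair $(a,b)\in\mathbb{R}^2$, $$\lim_{n\to\infty}\frac1n\log\left\|\prod_{k=0}^{n-1}\begin{bmatrix}0&1\\1&e^{2\pi i(ka+b)}\end{bmatrix}\right\|=0 .$$
   Context: The product of $2\times 2$ complex matrices is taken from left to right in order of increasing $k$, and $\|\cdot\|$ is a matrix norm on $\mathbb{C}^{2\times 2}$ (the choice of norm is irrelevant, since all are equivalent). *)

(* Defs.v *)
From mathcomp Require Import all_boot all_order all_algebra.
From mathcomp Require Import complex.
From mathcomp Require Import all_classical all_reals all_analysis.

Set Implicit Arguments.
Unset Strict Implicit.
Unset Printing Implicit Defensive.

Import Order.TTheory GRing.Theory Num.Theory.
Import numFieldNormedType.Exports.

Local Open Scope ring_scope.
Local Open Scope complex_scope.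

(* A vector-space norm on the 2x2 complex matrices; submultiplicativity is not
   required. *)
Record is_matrix_norm (R : realType) (N : 'M[R[i]]_2 -> R) : Prop := {
  matrix_norm_ge0 : forall A, 0 <= N A;
  matrix_norm_eq0 : forall A, N A = 0 -> A = 0;
  matrix_normZ : forall (c : R[i]) A, N (c *: A) = complex.Re `|c| * N A;
  matrix_normD : forall A B, N (A + B) <= N A + N B
}.

(* e^(it) for real t, by Euler's formula. *)
Definition expi (R : realType) (t : R) : R[i] := cos t +i* sin t.

Definition transfer_mx (R : realType) (a b : R) (k : nat) : 'M[R[i]]_2 :=
  \matrix_(i < 2, j < 2)
    nth 0 (nth [::] [:: [:: 0; 1]; [:: 1; expi (2 * pi * (k%:R * a + b))]] i) j.

(* Main.v *)
Require Import Defs.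
From mathcomp Require Import all_boot all_order all_algebra.
From mathcomp Require Import complex.
From mathcomp Require Import all_classical all_reals all_analysis.
From mathcomp Require Import zify ring lra.

Import Order.TTheory GRing.Theory Num.Theory.
Import numFieldNormedType.Exports.

Local Open Scope classical_set_scope.
Local Open Scope ring_scope.

(** The limit is 0 for every b as soon as a satisfies a Diophantine condition
    |i a - p| >= c / i^2, and almost every a does (ae_diophantine).

    Put w = e^(2 pi i a) and z = e^(2 pi i b).  The entries of the product are
    continuants of the geometric progression z, z w, z w^2, ..., and these have
    a closed form (skew_continuantE): a sum of at most n + 1 monomials in z
    whose coefficients are, up to powers of w, the Gaussian binomials

      g (j + l) / (g j * g l),   g m = (1 - w^2) (1 - w^4) ... (1 - w^(2m)),

    with 2 j + l = n.  As |z| = |w| = 1, it suffices that |g m| grows and decays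
    at most subexponentially; with th = 2 a, g m is the product of the factors
    1 - e^(2 pi i k th), 1 <= k <= m.

    Upper bound (prod_cabs_sub_le).  Cut the product into blocks of length q,
    where p / q is a good approximation of th.  In a block the points
    e^(2 pi i k th) nearly form a translate of the q-th roots of unity, and
    the product of x - u over these roots u is x^q - 1.  Moving x slightly
    inside the unit disc makes the comparison harmless and costs a factor
    close to 1 per term.

    Lower bound (prod_cabs_sub_cis_ge).  Given m, the pigeonhole principle
    provides p / q with q <= T m and |th - p / q| <= 1 / (T m q), where T is a
    large constant.  For k <= m not divisible by q, the factors for th and for
    p / q then have a ratio close to 1.  For p / q the product over a full
    period is exactly q, and an incomplete period is q divided by its
    complement, which is controlled by the upper bound.  The Diophantine
    condition makes q large, so that the factors with q | k are few, and it
    bounds each of them below polynomially.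

    This gives norms at most C rho^n for every rho > 1.  In the other
    direction, the determinant of the product has modulus 1, so that some entry
    has modulus at least 1 / 2.  Both bounds pass to an arbitrary norm, since all
    norms on 2 x 2 matrices are equivalent. *)

Set Implicit Arguments.
Unset Strict Implicit.
Unset Printing Implicit Defensive.

(** * The modulus of a complex number *)

(** The norm of R[i] takes its values in R[i]; the estimates below need a
    modulus in R. *)
Definition cabs (R : realType) (z : R[i]%C) : R := complex.Re `|z|.

Lemma cabsE (R : realType) (z : R[i]%C) : `|z| = ((cabs z)%:C)%C.
Proof. by rewrite /cabs normc_def. Qed.

Lemma cabs_sqrE (R : realType) (z : R[i]%C) :
  cabs z ^+ 2 = complex.Re z ^+ 2 + complex.Im z ^+ 2.
Proof. by apply: complexI; rewrite add_Re2_Im2 cabsE rmorphXn. Qed.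

Lemma cabs_ge0 (R : realType) (z : R[i]%C) : 0 <= cabs z.
Proof. by rewrite -ler0c -cabsE. Qed.

Lemma cabsM (R : realType) (z w : R[i]%C) : cabs (z * w) = cabs z * cabs w.
Proof. by apply: complexI; rewrite rmorphM /= -!cabsE normrM. Qed.

Lemma cabsD (R : realType) (z w : R[i]%C) : cabs (z + w) <= cabs z + cabs w.
Proof. by rewrite -lecR rmorphD /= -!cabsE ler_normD. Qed.

Lemma cabsN (R : realType) (z : R[i]%C) : cabs (- z) = cabs z.
Proof. by apply: complexI; rewrite -!cabsE normrN. Qed.

Lemma cabsV (R : realType) (z : R[i]%C) : cabs z^-1 = (cabs z)^-1.
Proof. by apply: complexI; rewrite fmorphV /= -!cabsE normfV. Qed.

Lemma cabs0 (R : realType) : cabs (0 : R[i]%C) = 0.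
Proof. by rewrite /cabs normr0. Qed.

Lemma cabs1 (R : realType) : cabs (1 : R[i]%C) = 1.
Proof. by rewrite /cabs normr1. Qed.

Lemma cabs_eq0 (R : realType) (z : R[i]%C) : (cabs z == 0) = (z == 0).
Proof. by rewrite -[RHS]normr_eq0 cabsE -(inj_eq (@complexI R)). Qed.

Lemma cabsB (R : realType) (z w : R[i]%C) : cabs z <= cabs w + cabs (z - w).
Proof. by rewrite -{1}[z](subrK w) addrC; exact: cabsD. Qed.

Lemma cabs_distC (R : realType) (z w : R[i]%C) : cabs (z - w) = cabs (w - z).
Proof. by rewrite -cabsN opprB. Qed.

Lemma cabs_real (R : realType) (x : R) : 0 <= x -> cabs (x%:C)%C = x.
Proof. by move=> x0; apply: complexI; rewrite -cabsE ger0_norm // ler0c. Qed.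

Lemma cabsX (R : realType) (z : R[i]%C) n : cabs (z ^+ n) = cabs z ^+ n.
Proof. by elim: n => [|n IH]; rewrite ?expr0 ?cabs1 // !exprS cabsM IH. Qed.

Lemma cabs_prod (R : realType) (I : Type) (r : seq I) (P : pred I)
    (F : I -> R[i]%C) :
  cabs (\prod_(i <- r | P i) F i) = \prod_(i <- r | P i) cabs (F i).
Proof. exact: (big_morph _ (@cabsM R) (@cabs1 R)). Qed.

Lemma cabs_sum (R : realType) (I : Type) (r : seq I) (P : pred I)
    (F : I -> R[i]%C) :
  cabs (\sum_(i <- r | P i) F i) <= \sum_(i <- r | P i) cabs (F i).
Proof.
apply: (big_ind2 (fun z x => cabs z <= x)) => // [|z x w y zx wy].
  by rewrite cabs0.
exact: le_trans (cabsD _ _) (lerD _ _).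
Qed.

(** * The character e^(2 pi i x) *)

Definition cis (R : realType) (x : R) : R[i]%C := expi (2 * pi * x).

Lemma expiD (R : realType) (s t : R) : expi (s + t) = expi s * expi t.
Proof. by rewrite /expi cosD sinD; congr (_ +i* _)%C; rewrite addrC mulrC. Qed.

Lemma cisD (R : realType) (x y : R) : cis (x + y) = cis x * cis y.
Proof. by rewrite /cis mulrDr expiD. Qed.

Lemma cis0 (R : realType) : cis (0 : R) = 1.
Proof. by rewrite /cis mulr0 /expi cos0 sin0. Qed.

Lemma cis_natM (R : realType) n (x : R) : cis (n%:R * x) = cis x ^+ n.
Proof.
elim: n => [|n IH]; first by rewrite mul0r cis0 expr0.
by rewrite -addn1 natrD mulrDl mul1r cisD IH exprD expr1.
Qed.

Lemma cisN (R : realType) (x : R) : cis x * cis (- x) = 1.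
Proof. by rewrite -cisD subrr cis0. Qed.

Lemma cis_nat (R : realType) n : cis (n%:R : R) = 1.
Proof.
suff h : cis (1 : R) = 1 by rewrite -[n%:R]mulr1 cis_natM h expr1n.
by rewrite /cis mulr1 mulr_natl /expi cos2pi sin2pi.
Qed.

Lemma cis_int (R : realType) (n : int) : cis (n%:~R : R) = 1.
Proof.
case: n => n; first exact: cis_nat.
have := cisN (n.+1%:R : R); rewrite cis_nat mul1r => h.
by rewrite NegzE rmorphN /=; exact: h.
Qed.

Lemma cabs_cis (R : realType) (x : R) : cabs (cis x) = 1.
Proof.
apply/eqP; rewrite -(@eqrXn2 _ 2) // ?cabs_ge0 // cabs_sqrE /= cos2Dsin2.
by rewrite expr1n.
Qed.

Lemma cis_neq0 (R : realType) (x : R) : cis x != 0.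
Proof. by rewrite -cabs_eq0 cabs_cis oner_eq0. Qed.

Lemma cabs_sub_cis (R : realType) (x : R) : cabs (1 - cis x) = 2 * `|sin (pi * x)|.
Proof.
apply/eqP; rewrite -(@eqrXn2 _ 2) ?cabs_ge0 ?mulr_ge0 // cabs_sqrE.
rewrite exprMn real_normK ?num_real //= /cis /expi.
rewrite (_ : 2 * pi * x = (pi * x) *+ 2); last by rewrite mulr2n; ring.
rewrite cos_mulr2n sin_mulr2n; set s := sin _; set c := cos _.
have h : c ^+ 2 = 1 - s ^+ 2 by rewrite /c cos2sin2.
apply/eqP; rewrite /= !mulr2n.
rewrite (_ : (0 - _) ^+ 2 = 4 * c ^+ 2 * s ^+ 2); last by ring.
rewrite h; ring.
Qed.

Lemma sin_MVT (R : realType) (v : R) : 0 <= v ->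
  exists2 c, 0 <= c <= v & sin v = cos c * v.
Proof.
move=> v0; have [|c] := @MVT_segment R sin cos 0 v v0 (fun x _ => is_derive_sin x).
  by apply: continuous_subspaceT => x; exact: continuous_sin.
by rewrite in_itv /= sin0 !subr0 => cv ->; exists c.
Qed.

Lemma norm_sin_le (R : realType) (v : R) : `|sin v| <= `|v|.
Proof.
wlog v0 : v / 0 <= v => [hw|].
  have [/hw //|/ltW v0] := leP 0 v.
  by rewrite -[`|sin v|]normrN -sinN -[`|v|]normrN; apply: hw; rewrite oppr_ge0.
have [c _ ->] := sin_MVT v0.
by rewrite normrM ler_piMl // cos_max.
Qed.

(** Halve the angle: sin u = 2 cos (u/2) sin (u/2), the mean value theorem
    bounds sin (u/2) below, and 2 cos^2 (u/2) = 1 + cos u >= 1. *)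
Lemma sin_ge_half (R : realType) (u : R) : 0 <= u <= pi / 2 -> u / 2 <= sin u.
Proof.
move=> /andP[u0 u1]; set v := u / 2.
have v0 : 0 <= v by rewrite divr_ge0.
have vu : v <= u by rewrite /v; lra.
have upi : u <= pi by apply: le_trans u1 _; have := @pi_ge0 R; lra.
have uE : u = v *+ 2 by rewrite /v mulr2n; lra.
have [c /andP[c0 cv] sv] := sin_MVT v0.
have cosv0 : 0 <= cos v by apply: cos_ge0_pihalf; apply/andP; split; lra.
have cosu0 : 0 <= cos u by apply: cos_ge0_pihalf; apply/andP; split; lra.
have cc : cos v <= cos c.
  move: cv; rewrite le_eqVlt => /predU1P[-> //|cv]; apply: ltW.
  by rewrite ltr_cos // in_itv /=; apply/andP; split; lra.
rewrite uE sin_mulr2n sv mulr2n.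
have : 1 <= 2 * cos v ^+ 2 by move: cosu0; rewrite uE cos_mulr2n mulr2n; lra.
have : cos v * cos v <= cos v * cos c by rewrite ler_wpM2l.
rewrite expr2 => h1 h2.
have h : 1 <= 2 * (cos v * cos c) by lra.
have := ler_wpM2r v0 h; rewrite mul1r => {}h.
lra.
Qed.

Lemma cabs_sub_cis_le (R : realType) (x : R) : cabs (1 - cis x) <= 8 * `|x|.
Proof.
rewrite cabs_sub_cis; have := norm_sin_le (pi * x).
rewrite normrM gtr0_norm ?pi_gt0 // => h.
have : pi * `|x| <= 4 * `|x|.
  by rewrite ler_wpM2r //; have := @pihalf_lt2 R; lra.
lra.
Qed.

Lemma cabs_cisB_le (R : realType) (x y : R) : cabs (cis x - cis y) <= 8 * `|x - y|.
Proof.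
have -> : cis y = cis x * cis (y - x) by rewrite -cisD addrC subrK.
by rewrite -{1}[cis x]mulr1 -mulrBr cabsM cabs_cis mul1r distrC cabs_sub_cis_le.
Qed.

(** The distance from cis x to 1 is comparable to the distance from x to the
    nearest integer, here floor (x + 1/2). *)
Lemma cabs_sub_cis_ge (R : realType) (x d : R) :
  (forall p : int, d <= `|x - p%:~R|) -> 2 * d <= cabs (1 - cis x).
Proof.
pose p := Num.floor (x + 1 / 2); set y := x - p%:~R => hd.
have -> : cis x = cis y.
  by rewrite -[x](subrK p%:~R) -/y cisD cis_int mulr1.
have yh : `|y| <= 1 / 2.
  have := floor_le (x + 1 / 2); have := floorD1_gt (x + 1 / 2).
  rewrite -/p rmorphD /= => h1 h2; rewrite ler_norml /y; lra.
apply: (@le_trans _ _ (2 * `|y|)); first by rewrite ler_pM2l // hd.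
rewrite cabs_sub_cis ler_pM2l //.
have -> : `|sin (pi * y)| = `|sin (pi * `|y|)|.
  by case: (ger0P y) => // _; rewrite mulrN sinN normrN.
apply: le_trans (ler_norm _).
have := @pi_ge2 R; have := normr_ge0 y => y0 pi2.
apply: le_trans (sin_ge_half _); last by apply/andP; split; nra.
nra.
Qed.

(** * Rational approximation *)

Lemma exponential_beats_power (R : realType) (x A : R) (k : nat) : 1 < x ->
  exists n0 : nat, forall n : nat, (n0 <= n)%N -> A * n%:R ^+ k <= x ^+ n.
Proof.
move=> x1; have x0 : 0 < x by apply: lt_trans x1.
have L0 : 0 < ln x by rewrite ln_gt0.
pose B : R := `|A| * (k.+1)`!%:R / ln x ^+ k.+1.
have B0 : 0 <= B by rewrite divr_ge0 ?exprn_ge0 ?mulr_ge0 // ltW.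
exists (Num.bound B) => n nB.
have Bn : B <= n%:R.
  by apply: le_trans (ltW (archi_boundP B0)) _; rewrite ler_nat.
have -> : x ^+ n = expR (n%:R * ln x) by rewrite mulrC expRM_natr lnK.
have nL0 : 0 <= n%:R * ln x by rewrite mulr_ge0 // ltW.
apply: le_trans (expR_ge1Dxn k nL0).
apply: (@le_trans _ _ ((n%:R * ln x) ^+ k.+1 / (k.+1)`!%:R)); last first.
  by rewrite lerDr.
apply: (@le_trans _ _ (`|A| * n%:R ^+ k)).
  by rewrite ler_wpM2r ?exprn_ge0 // ler_norm.
rewrite ler_pdivlMr ?ltr0n ?fact_gt0 // exprMn.
move: Bn; rewrite /B ler_pdivrMr ?exprn_gt0 // => Bn.
rewrite mulrAC (exprS n%:R) [leRHS]mulrAC.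
by rewrite ler_wpM2r ?exprn_ge0.
Qed.

Lemma dirichlet_pigeonhole (R : realType) (th : R) (Q : nat) : (0 < Q)%N ->
  exists q (p : int), (0 < q <= Q)%N /\ `|q%:R * th - p%:~R| <= Q%:R^-1.
Proof.
case: Q => // Q _.
(* Boxes: the intervals [k / Q, (k + 1) / Q); objects: the fractional parts
   of i th, for i <= Q. *)
pose fr (i : nat) := i%:R * th - (Num.floor (i%:R * th))%:~R.
have fr0 i : 0 <= fr i by rewrite subr_ge0 floor_le.
have fr1 i : fr i < 1.
  by rewrite ltrBlDr addrC; have := floorD1_gt (i%:R * th); rewrite rmorphD.
have Q0 : 0 < Q.+1%:R :> R by rewrite ltr0n.
pose f (i : 'I_Q.+2) : 'I_Q.+1 := inord (Num.truncn (Q.+1%:R * fr i)).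
have fE i : (f i)%:R <= Q.+1%:R * fr i < (f i).+1%:R.
  rewrite /f inordK; last first.
    by rewrite ltnS truncn_le_nat gtr_pMr.
  by rewrite truncn_le truncnS_gt andbT mulr_ge0.
have /injectivePn[i [j ij fij]] : ~~ injectiveb f.
  by apply/negP => /injectiveP/leq_card; rewrite !card_ord ltnn.
wlog ltij : i j ij fij / (i < j)%N => [hw|].
  have [ltij|ltji|/val_inj eij] := ltngtP i j; first exact: (hw i j).
    by apply: (hw j i) => //; rewrite eq_sym.
  by rewrite eij eqxx in ij.
exists (j - i)%N, (Num.floor (j%:R * th) - Num.floor (i%:R * th)); split.
  by have := ltn_ord j; lia.
rewrite natrB ?(ltnW ltij) // rmorphB /=.
rewrite (_ : _ - _ = fr j - fr i); last by rewrite /fr; ring.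
rewrite -(ler_pM2l Q0) divff ?gt_eqF // -{1}(gtr0_norm Q0) -normrM mulrBr.
have := fE i; have := fE j; rewrite fij -natr1 ler_norml; lra.
Qed.

(** A denominator of minimal size is automatically in lowest terms, since
    any cancellation would produce a smaller one with the same quality. *)
Lemma dirichlet_reduced (R : realType) (th : R) (Q : nat) : (0 < Q)%N ->
  exists q (p : int), [/\ (0 < q <= Q)%N, `|q%:R * th - p%:~R| <= Q%:R^-1 &
    forall (i : nat) (k : int), (0 < i < q)%N -> i%:Z * p != k * q%:Z].
Proof.
move=> Q0; pose P q := (0 < q <= Q)%N &&
  `[< exists p : int, `|q%:R * th - p%:~R| <= Q%:R^-1 >].
have exP : exists q, P q.
  have [q [p [qQ hp]]] := dirichlet_pigeonhole th Q0.
  by exists q; rewrite /P qQ; apply/asboolP; exists p.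
have [q /andP[/andP[q0 qQ] /asboolP[p hp]] qmin] := ex_minnP exP.
exists q, p; split; [exact/andP|exact: hp|move=> i k /andP[i0 iq]].
apply/negP => /eqP ipkq.
suff /qmin : P i by rewrite leqNgt iq.
rewrite /P i0 (leq_trans (ltnW iq) qQ); apply/asboolP; exists k.
have q0R : 0 < q%:R :> R by rewrite ltr0n.
have kE : k%:~R = i%:R * p%:~R / q%:R :> R.
  have /(congr1 (fun z : int => z%:~R : R)) := ipkq.
  by rewrite !rmorphM /= => ->; rewrite mulfK ?gt_eqF.
rewrite kE (_ : _ - _ = i%:R / q%:R * (q%:R * th - p%:~R)); last first.
  by field; rewrite gt_eqF.
rewrite normrM; apply: le_trans hp; rewrite ler_piMl //.
by rewrite ger0_norm ?divr_ge0 // ler_pdivrMr // mul1r ler_nat ltnW.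
Qed.

(** The roots of unity cis (i p / q), 0 < i < q, stay at distance at least
    2 / q from 1; this is the quantitative form in which the reducedness of
    a fraction is used. *)
Definition separated_fraction (R : realType) (al : R) (q : nat) : Prop :=
  (exists p : int, al = p%:~R / q%:R) /\
  forall i : nat, (0 < i < q)%N -> 2 / q%:R <= cabs (1 - cis (i%:R * al)).

Lemma dirichlet_separated (R : realType) (th : R) (Q : nat) : (0 < Q)%N ->
  exists q (al : R), [/\ (0 < q <= Q)%N, q%:R * `|th - al| <= Q%:R^-1 &
    separated_fraction al q].
Proof.
move=> Q0; have [q [p [qQ hp hr]]] := dirichlet_reduced th Q0.
have /andP[q0 _] := qQ; have q0R : 0 < q%:R :> R by rewrite ltr0n.
exists q, (p%:~R / q%:R); split => //.
  rewrite -{1}(gtr0_norm q0R) -normrM mulrBr mulrCA divff ?gt_eqF //.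
  by rewrite mulr1.
split; first by exists p.
move=> i iq; apply: cabs_sub_cis_ge => k.
rewrite (_ : _ - _ = (i%:Z * p - k * q%:Z)%:~R / q%:R); last first.
  by rewrite rmorphB !rmorphM /=; field; rewrite gt_eqF.
rewrite normrM normfV (gtr0_norm q0R) -[leLHS]mul1r ler_pM2r ?invr_gt0 //.
rewrite -intr_norm (_ : 1 = 1%:~R) // ler_int -gtz0_ge1 normr_gt0 subr_eq0.
exact: hr.
Qed.

Lemma separated_fraction_prim (R : realType) (al : R) (q : nat) :
  (0 < q)%N -> separated_fraction al q -> q.-primitive_root (cis al).
Proof.
move=> q0 [[p alE] sep]; have q0R : 0 < q%:R :> R by rewrite ltr0n.
have cisq : cis al ^+ q = 1.
  by rewrite -cis_natM alE mulrCA divff ?gt_eqF // mulr1 cis_int.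
have [m prim_m mq] := prim_order_exists q0 cisq.
have m0 := prim_order_gt0 prim_m.
have := dvdn_leq q0 mq; rewrite leq_eqVlt => /predU1P[<- //|mltq].
have /sep : (0 < m < q)%N by rewrite m0.
rewrite cis_natM (prim_expr_order prim_m) subrr cabs0.
by rewrite leNgt divr_gt0.
Qed.

Lemma prod_sub_cis (R : realType) (al : R) (q : nat) (x : R[i]%C) :
  (0 < q)%N -> separated_fraction al q ->
  \prod_(0 <= j < q) (x - cis (j%:R * al)) = x ^+ q - 1.
Proof.
move=> q0 sep; have prim := separated_fraction_prim q0 sep.
have := congr1 (fun p => p.[x]) (factor_Xn_sub_1 prim).
rewrite horner_prod !hornerE => <-.
by apply: eq_bigr => j _; rewrite !hornerE cis_natM.
Qed.

(** What matters below is that the lower bound is polynomial in i; the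
    exponent 2 is large enough for almost every th to satisfy it. *)
Definition diophantine (R : realType) (c th : R) : Prop :=
  0 < c /\ forall (i : nat) (p : int), (0 < i)%N ->
    c / i%:R ^+ 2 <= `|i%:R * th - p%:~R|.

(** Compare the quality of the approximation with the Diophantine lower bound
    at i = q. *)
Lemma diophantine_denominator (R : realType) (c th al : R) (q Q : nat) :
  diophantine c th -> (0 < q)%N -> (0 < Q)%N -> separated_fraction al q ->
  q%:R * `|th - al| <= Q%:R^-1 -> c * Q%:R <= q%:R ^+ 2.
Proof.
move=> [c0 hc] q0 Q0 [[p alE] _] hal.
have q0R : 0 < q%:R :> R by rewrite ltr0n.
have Q0R : 0 < Q%:R :> R by rewrite ltr0n.
rewrite -{1}(gtr0_norm q0R) -normrM in hal.
have e : q%:R * th - p%:~R = q%:R * (th - al).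
  by rewrite alE; field; rewrite gt_eqF.
have := hc q p q0; rewrite e => /le_trans/(_ hal).
by rewrite ler_pdivrMr ?exprn_gt0 // ler_pdivlMl // mulrC.
Qed.

Lemma diophantine_approx (R : realType) (c th : R) (n0 : nat) :
  diophantine c th -> exists q (al : R),
    [/\ (n0 <= q)%N, (0 < q)%N, `|th - al| <= (q%:R ^+ 2)^-1 &
        separated_fraction al q].
Proof.
move=> dth; have [c0 _] := dth.
have A0 : 0 <= n0%:R ^+ 2 / c :> R by rewrite divr_ge0 ?exprn_ge0 // ltW.
pose Q := (Num.bound (n0%:R ^+ 2 / c : R)).+1.
have Qb : n0%:R ^+ 2 / c <= Q%:R :> R.
  by apply: le_trans (ltW (archi_boundP A0)) _; rewrite ler_nat.
have [q [al [/andP[q0 qQ] hal sep]]] := @dirichlet_separated _ th Q isT.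
have q0R : 0 < q%:R :> R by rewrite ltr0n.
exists q, al; split => //.
  have := diophantine_denominator (Q := Q) dth q0 isT sep hal.
  move: Qb; rewrite ler_pdivrMr // mulrC => h1 h2.
  have := le_trans h1 h2; rewrite ler_pXn2r ?nnegrE // ler_nat //.
rewrite expr2 invfM ler_pdivlMl //; apply: le_trans hal _.
by rewrite lef_pV2 ?posrE ?ltr0n // ler_nat.
Qed.

(** * Subexponential growth of the products *)

(** Replacing y by the interior point y / s costs only a factor s, and makes
    the logarithm of the distance to points of the unit circle Lipschitz.  With
    t = 1 / s, |y - t z| = |t y - z| and (1 + t) (y - z) is the sum of
    y - t z and t y - z; finally 2 / (1 + t) <= s. *)
Lemma cabs_sub_le_shrink (R : realType) (s : R) (y z : R[i]%C) : 1 < s ->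
  cabs y = 1 -> cabs z = 1 -> cabs (y - z) <= s * cabs ((s^-1)%:C%C * y - z).
Proof.
move=> s1 y1 z1; have s0 : 0 < s by apply: lt_trans s1.
pose t := s^-1; have t0 : 0 < t by rewrite invr_gt0.
have ts : s * t = 1 by rewrite divff ?gt_eqF.
rewrite -/t; have e : cabs (y - t%:C%C * z) = cabs (t%:C%C * y - z).
  apply/eqP; rewrite -(@eqrXn2 _ 2) ?cabs_ge0 // !cabs_sqrE.
  have := cabs_sqrE y; have := cabs_sqrE z; rewrite y1 z1 expr1n.
  case: y z {y1 z1} => a b [a' b'] /= h1 h2; rewrite -subr_eq0; apply/eqP.
  transitivity ((1 - t ^+ 2) * ((a ^+ 2 + b ^+ 2) - (a' ^+ 2 + b' ^+ 2))).
    by ring.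
  by rewrite -h1 -h2 subrr mulr0.
have h : (1 + t) * cabs (y - z) <= 2 * cabs (t%:C%C * y - z).
  have -> : 1 + t = cabs ((1 + t)%:C)%C by rewrite cabs_real // addr_ge0 // ltW.
  rewrite -cabsM (_ : _ * _ = (y - t%:C%C * z) + (t%:C%C * y - z)).
    by apply: le_trans (cabsD _ _) _; rewrite e mulr2n mulrDl mul1r.
  by rewrite rmorphD rmorph1; ring.
have st : 2 <= s * (1 + t) by rewrite mulrDr ts; lra.
have t1 : 0 < 1 + t by lra.
rewrite -(ler_pM2l t1); apply: le_trans h _.
rewrite mulrA ler_wpM2r ?cabs_ge0 //; lra.
Qed.

(** Each point of the block is within 16 / q of a q-th root of unity, while
    y / s is at distance at least 1 - 1 / s from the circle: replacing all the
    points by roots of unity costs at most a factor (1 + K / q)^q <= e^K, where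
    K = 16 / (1 - 1 / s). *)
Lemma prod_cabs_sub_block (R : realType) (s al0 al : R) (q : nat) (y : R[i]%C) :
  1 < s -> (0 < q)%N -> separated_fraction al0 q ->
  `|al - al0| <= 2 / q%:R ^+ 2 -> cabs y = 1 ->
  \prod_(0 <= j < q) cabs (y - cis (j%:R * al))
    <= 2 * expR (16 / (1 - s^-1)) * s ^+ q.
Proof.
move=> s1 q0 sep hal y1; have s0 : 0 < s by apply: lt_trans s1.
have q0R : 0 < q%:R :> R by rewrite ltr0n.
pose t := s^-1; have t0 : 0 < t by rewrite invr_gt0.
have t1 : t < 1 by rewrite invf_lt1.
have t1' : 0 < 1 - t by rewrite subr_gt0.
rewrite -/t; pose K := 16 / (1 - t).
have K0 : 0 <= K by rewrite divr_ge0 // ltW.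
pose Y := (t%:C)%C * y.
have Yt : cabs Y = t by rewrite cabsM y1 mulr1 cabs_real // ltW.
have termle j : (j < q)%N -> cabs (y - cis (j%:R * al)) <=
    s * (1 + K / q%:R) * cabs (Y - cis (j%:R * al0)).
  move=> jq; apply: le_trans (cabs_sub_le_shrink s1 y1 (cabs_cis _)) _.
  rewrite -mulrA ler_pM2l // -/t -/Y.
  set z := cis (j%:R * al); set w := cis (j%:R * al0).
  have zw : cabs (w - z) <= 16 / q%:R.
    rewrite cabs_distC; apply: le_trans (cabs_cisB_le _ _) _.
    rewrite -mulrBr normrM ger0_norm //.
    have -> : 16 / q%:R = 8 * (q%:R * (2 / q%:R ^+ 2)) :> R.
      by field; rewrite gt_eqF.
    by rewrite ler_pM2l // ler_pM // ler_nat ltnW.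
  have Yw : 1 - t <= cabs (Y - w).
    have := cabsB w Y; rewrite cabs_cis Yt (cabs_distC w); lra.
  have h : cabs (Y - z) <= cabs (Y - w) + cabs (w - z).
    by rewrite -[Y - z](subrKA w); exact: cabsD.
  apply: le_trans h _; rewrite mulrDl mul1r lerD2l.
  apply: le_trans zw _; rewrite (_ : 16 / q%:R = K / q%:R * (1 - t)).
    by rewrite ler_wpM2l // divr_ge0.
  by rewrite /K; field; rewrite !gt_eqF.
apply: (@le_trans _ _ (\prod_(0 <= j < q)
    (s * (1 + K / q%:R) * cabs (Y - cis (j%:R * al0))))).
  rewrite !big_mkord; apply: ler_prod => j _.
  by rewrite cabs_ge0 termle.
rewrite big_split /= prodr_const_nat subn0 -cabs_prod prod_sub_cis // exprMn.
have h1 : cabs (Y ^+ q - 1) <= 2.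
  apply: le_trans (cabsD _ _) _; rewrite cabsN cabs1 cabsX Yt.
  have := exprn_ile1 q (ltW t0) (ltW t1); lra.
have h2 : (1 + K / q%:R) ^+ q <= expR K.
  have -> : expR K = expR (K / q%:R) ^+ q.
    by rewrite -expRM_natr mulfVK ?gt_eqF.
  have Kq : 0 <= K / q%:R by rewrite divr_ge0.
  by rewrite ler_pXn2r ?nnegrE ?expR_ge0 ?expR_ge1Dx ?addr_ge0.
have h0 : 0 <= (1 + K / q%:R) ^+ q by rewrite exprn_ge0 // addr_ge0 // divr_ge0.
rewrite [leRHS]mulrC -mulrA ler_pM2l ?exprn_gt0 // mulrC.
by rewrite ler_pM ?cabs_ge0.
Qed.

(** The length q of the blocks depends on rho only, and is chosen so large that
    the cost of a block, a constant times s^q with s < rho, is at most rho^q.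
    The uniformity in al near th is needed to apply the bound to rational
    approximations of th. *)
Lemma prod_cabs_sub_le (R : realType) (c th rho : R) :
  diophantine c th -> 1 < rho ->
  exists C eta : R, [/\ 0 < C, 0 < eta & forall al : R, `|th - al| <= eta ->
    forall (m : nat) (y : R[i]%C), cabs y = 1 ->
    \prod_(0 <= j < m) cabs (y - cis (j%:R * al)) <= C * rho ^+ m].
Proof.
move=> dth rho1; have rho0 : 0 < rho by apply: lt_trans rho1.
pose s := (1 + rho) / 2.
have s1 : 1 < s by rewrite /s; lra.
have s0 : 0 < s by apply: lt_trans s1.
have srho : 1 < rho / s by rewrite ltr_pdivlMr // mul1r /s; lra.
have [n0 hn0] :=
  exponential_beats_power (2 * expR (16 / (1 - s^-1))) 0 srho.
have [q [al0 [nq q0 hal0 sep]]] := diophantine_approx n0 dth.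
have q0R : 0 < q%:R :> R by rewrite ltr0n.
exists (2 ^+ q), (q%:R ^+ 2)^-1; split; rewrite ?exprn_gt0 // ?invr_gt0 ?exprn_gt0 //.
move=> al hal; elim/ltn_ind => m IH y y1.
have [mq|qm] := ltnP m q.
  apply: (@le_trans _ _ (2 ^+ m)).
    rewrite -[m in 2 ^+ m]subn0 -prodr_const_nat !big_mkord; apply: ler_prod => j _.
    rewrite cabs_ge0 /=; apply: le_trans (cabsD _ _) _.
    by rewrite cabsN cabs_cis y1.
  apply: (@le_trans _ _ (2 ^+ q)); first by rewrite ler_eXn2l ?ltr1n // ltnW.
  by rewrite ler_peMr ?exprn_ge0 // exprn_ege1 // ltW.
rewrite (@big_cat_nat _ _ _ q) //=.
rewrite -[X in _ * \prod_(X <= _ < _) _](add0n q) big_addn.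
have blk : \prod_(0 <= j < q) cabs (y - cis (j%:R * al)) <= rho ^+ q.
  apply: le_trans (prod_cabs_sub_block (s := s) (al0 := al0) _ _ _ _ _) _ => //.
    rewrite (_ : al - al0 = (th - al0) - (th - al)); last by ring.
    by apply: le_trans (ler_normB _ _) _; rewrite mulrDl mul1r lerD.
  have := hn0 q nq; rewrite expr0 mulr1 expr_div_n.
  by rewrite ler_pdivlMr ?exprn_gt0.
pose w := cis (q%:R * al).
have w1 : cabs w = 1 by exact: cabs_cis.
have -> : \prod_(0 <= j < m - q) cabs (y - cis ((j + q)%:R * al)) =
    \prod_(0 <= j < m - q) cabs (y / w - cis (j%:R * al)).
  apply: eq_bigr => j _; rewrite natrD mulrDl cisD -/w -[RHS]mulr1 -w1 -cabsM.
  by rewrite mulrBl divfK ?cis_neq0.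
rewrite -(subnKC qm) exprD mulrCA; apply: ler_pM => //.
- by apply: prodr_ge0 => j _; exact: cabs_ge0.
- by apply: prodr_ge0 => j _; exact: cabs_ge0.
rewrite subnKC //; apply: IH; first by lia.
by rewrite cabsM cabsV w1 y1 invr1 mulr1.
Qed.

(** * Subexponential decay of the products *)

Lemma root_gt1 (R : realType) (x : R) (k : nat) : (0 < k)%N -> 1 < x ->
  exists2 s : R, 1 < s & s ^+ k = x.
Proof.
move=> k0 x1; exists (expR (ln x / k%:R)).
  by rewrite expR_gt1 divr_gt0 ?ln_gt0 ?ltr0n.
rewrite -expRM_natr mulfVK ?pnatr_eq0 -?lt0n // lnK //.
by rewrite posrE; apply: lt_trans x1.
Qed.

Lemma cabs_sub_cis_diophantine (R : realType) (c th : R) (i : nat) :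
  diophantine c th -> (0 < i)%N -> 2 * (c / i%:R ^+ 2) <= cabs (1 - cis (i%:R * th)).
Proof. by move=> [_ hc] i0; apply: cabs_sub_cis_ge => p; exact: hc. Qed.

Lemma cabs_sub_cis_gt0 (R : realType) (c th : R) (i : nat) :
  diophantine c th -> (0 < i)%N -> 0 < cabs (1 - cis (i%:R * th)).
Proof.
move=> dth i0; apply: lt_le_trans (cabs_sub_cis_diophantine dth i0).
by rewrite mulr_gt0 // divr_gt0 ?exprn_gt0 ?ltr0n //; case: dth.
Qed.

Lemma cis_separated_mod (R : realType) (al : R) (q i : nat) :
  (0 < q)%N -> separated_fraction al q ->
  cis (i%:R * al) = cis ((i %% q)%N%:R * al).
Proof.
move=> q0 sep; rewrite !cis_natM.
by rewrite (prim_expr_mod (separated_fraction_prim q0 sep)).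
Qed.

(** Evaluate 1 + X + ... + X^(q-1) = (X^q - 1) / (X - 1) at 1. *)
Lemma prod_cabs_sub_period (R : realType) (al : R) (q : nat) :
  (0 < q)%N -> separated_fraction al q ->
  \prod_(1 <= i < q) cabs (1 - cis (i%:R * al)) = q%:R.
Proof.
move=> q0 sep; have prim := separated_fraction_prim q0 sep.
have : \prod_(1 <= i < q) ('X - (cis al ^+ i)%:P) = \sum_(i < q) 'X^i.
  have X1 : 'X - 1 != 0 :> {poly R[i]%C} by rewrite -polyC1 polyXsubC_eq0.
  apply: (mulfI X1); rewrite -subrX1 -(factor_Xn_sub_1 prim).
  by rewrite [RHS]big_ltn // expr0.
move=> /(congr1 (fun p => p.[1])); rewrite horner_prod horner_sum.
rewrite [RHS](eq_bigr (fun=> 1)) => [|i _]; last by rewrite hornerXn expr1n.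
rewrite sumr_const card_ord => /(congr1 (@cabs R)); rewrite cabs_prod.
have -> : 1 *+ q = ((q%:R : R)%:C)%C by rewrite rmorph_nat.
rewrite cabs_real // => <-.
by apply: eq_bigr => i _; rewrite !hornerE cis_natM.
Qed.

(** For a rational rotation the factors are periodic and the product of the
    nonzero ones over a period is q; an incomplete period is bounded below by
    bounding its complement above.  The vanishing factors are replaced by
    s ^- q; as there are at most m / q of them, they cost at most s^m. *)
Lemma prod_cabs_sub_rational_ge (R : realType) (al A s : R) (q : nat) :
  (0 < q)%N -> separated_fraction al q -> 1 < s -> 0 < A ->
  (forall (m : nat) (y : R[i]%C), (m < q)%N -> cabs y = 1 ->
     \prod_(0 <= j < m) cabs (y - cis (j%:R * al)) <= A) ->
  forall m, 1 <= A * s ^+ m * \prod_(1 <= i < m.+1)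
    (if (q %| i)%N then s ^- q else cabs (1 - cis (i%:R * al))).
Proof.
move=> q0 sep s1 A0 hA; have s0 : 0 < s by apply: lt_trans s1.
pose b i := if (q %| i)%N then s ^- q else cabs (1 - cis (i%:R * al)).
change (forall m, 1 <= A * s ^+ m * \prod_(1 <= i < m.+1) b i).
have bE i : (0 < i < q)%N -> b i = cabs (1 - cis (i%:R * al)).
  move=> /andP[i0 iq]; rewrite /b ifN //.
  by apply/negP => /(dvdn_leq i0); rewrite leqNgt iq.
have b0 i : 0 <= b i.
  by rewrite /b; case: ifP => _; rewrite ?cabs_ge0 // invr_ge0 exprn_ge0 // ltW.
have bq i : b (i + q)%N = b i.
  rewrite /b dvdn_addl // (cis_separated_mod (i + q) q0 sep) modnDr.
  by rewrite -(cis_separated_mod i q0 sep).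
have per : \prod_(1 <= i < q) b i = q%:R.
  rewrite -(prod_cabs_sub_period q0 sep) big_nat [RHS]big_nat.
  exact: eq_bigr.
have q1 : 1 <= q%:R :> R by rewrite ler1n.
elim/ltn_ind => m IH; have [mq|qm] := ltnP m q.
  have := per; rewrite (@big_cat_nat _ _ _ m.+1) //= => perE.
  have rest : \prod_(m.+1 <= i < q) b i <= A.
    rewrite -[X in \prod_(X <= _ < _) _](add0n m.+1) big_addn.
    pose w := cis (m.+1%:R * al); have w1 : cabs w = 1 by exact: cabs_cis.
    apply: le_trans (hA (q - m.+1)%N w^-1 _ _); last 2 first.
    - lia.
    - by rewrite cabsV w1 invr1.
    rewrite big_nat [leRHS]big_nat le_eqVlt; apply/orP; left; apply/eqP.
    apply: eq_bigr => j /andP[_ jq]; rewrite bE; last by lia.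
    rewrite natrD mulrDl cisD -/w -[RHS]mulr1 -w1 -cabsM mulrBl.
    by rewrite mulVf ?cis_neq0.
  have P0 : 0 <= \prod_(1 <= i < m.+1) b i by apply: prodr_ge0.
  apply: (@le_trans _ _ (A * \prod_(1 <= i < m.+1) b i)).
    by apply: le_trans q1 _; rewrite -perE mulrC ler_wpM2r.
  by rewrite ler_wpM2r // ler_peMr ?exprn_ege1 // ltW.
have mq : (m - q < m)%N by lia.
apply: le_trans (IH _ mq) _.
have -> : \prod_(1 <= i < m.+1) b i =
    q%:R * b q * \prod_(1 <= i < (m - q).+1) b i.
  rewrite (@big_cat_nat _ _ _ q.+1) //= big_nat_recr //= per; congr (_ * _).
  rewrite -{1}(add1n q) big_addn subSn //.
  by apply: eq_bigr => i _; rewrite bq.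
set P := \prod_(_ <= _ < _) _; have P0 : 0 <= P by apply: prodr_ge0.
rewrite {1}/b dvdnn -[in leRHS](subnK qm) exprD.
rewrite [leRHS](_ : _ = A * s ^+ (m - q) * P * (q%:R * (s ^+ q / s ^+ q))).
  by rewrite divff ?expf_neq0 ?gt_eqF // mulr1 ler_peMr // !mulr_ge0 ?exprn_ge0 // ltW.
by ring.
Qed.

(** Compare th with a fraction al of denominator q <= T m.  Three errors, each
    at most s^m with s^3 = rho, have to be absorbed: the ratios of the factors
    for th and al, the factors with q | i, and the incomplete period. *)
Lemma prod_cabs_sub_cis_ge_eventually (R : realType) (c th rho : R) :
  diophantine c th -> 1 < rho ->
  exists (C : R) (m0 : nat), 0 < C /\ forall m, (m0 <= m)%N ->
    1 <= C * rho ^+ m * \prod_(1 <= i < m.+1) cabs (1 - cis (i%:R * th)).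
Proof.
move=> dth rho1; have [c0 _] := dth.
have [s s1 <-] := @root_gt1 _ rho 3 isT rho1.
have s0 : 0 < s by apply: lt_trans s1.
have si1 : 0 < 1 - s^-1 by rewrite subr_gt0 invf_lt1.
(* For q not dividing i, the error 8 / (T q) is at most a proportion 4 / T of
   the factor for al, which is at least 2 / q. *)
pose T := (Num.bound (4 / (1 - s^-1))).+1.
have T0 : 0 < T%:R :> R by rewrite ltr0n.
have Tb : 4 / T%:R <= 1 - s^-1.
  rewrite ler_pdivrMr // mulrC -ler_pdivrMr //.
  apply: le_trans (ltW (archi_boundP _)) _; first by rewrite divr_ge0 // ltW.
  by rewrite ler_nat.
(* The complement of the incomplete period has up to q <= T m factors, so the
   upper bound is needed at the rate s' with s'^T = s. *)
have [s' s'1 s'E] := @root_gt1 _ s T isT s1.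
have [C [eta [C0 eta0 hC]]] := prod_cabs_sub_le dth s'1.
(* For q | i, the factor is at least 2 c / m^2, and c m <= q^2: the fourth
   power of q has to be beaten by s^q. *)
have [n0 hn0] := exponential_beats_power (2 * c ^+ 3)^-1 4 s1.
pose B : R := n0%:R ^+ 2 / c + eta^-1 + 1.
have B0 : 0 <= B by rewrite !addr_ge0 ?divr_ge0 ?invr_ge0 ?exprn_ge0 // ltW.
exists C, (Num.bound B); split => // m mB.
have {mB B0} Bm : B <= m%:R.
  by apply: le_trans (ltW (archi_boundP B0)) _; rewrite ler_nat.
have nc0 : 0 <= n0%:R ^+ 2 / c by rewrite divr_ge0 ?exprn_ge0 // ltW.
have ie0 : 0 < eta^-1 by rewrite invr_gt0.
have m0R : 0 < m%:R :> R by move: Bm; rewrite /B; lra.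
have m0 : (0 < m)%N by rewrite -(ltr0n R).
have Q0 : (0 < T * m)%N by rewrite muln_gt0.
have [q [al [/andP[q0 qQ] hal sep]]] := dirichlet_separated th Q0.
have q0R : 0 < q%:R :> R by rewrite ltr0n.
have cq := diophantine_denominator dth q0 Q0 sep hal.
have cmq : c * m%:R <= q%:R ^+ 2.
  by apply: le_trans cq; rewrite ler_pM2l // ler_nat leq_pmull.
have nq : (n0 <= q)%N.
  have : n0%:R ^+ 2 / c <= m%:R by move: Bm; rewrite /B; lra.
  rewrite ler_pdivrMr // mulrC => /le_trans/(_ cmq).
  by rewrite ler_pXn2r ?nnegrE // ler_nat.
have dal : `|th - al| <= (T * m)%:R^-1 / q%:R by rewrite ler_pdivlMr // mulrC.
have aleta : `|th - al| <= eta.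
  apply: le_trans dal _; rewrite ler_pdivrMr //.
  apply: (@le_trans _ _ eta); last by rewrite ler_peMr ?ler1n // ltW.
  rewrite -[eta]invrK lef_pV2 ?posrE ?ltr0n //.
  apply: (@le_trans _ _ m%:R); last by rewrite ler_nat leq_pmull.
  by move: Bm; rewrite /B; lra.
have sm q' : (q' < q)%N -> s' ^+ q' <= s ^+ m.
  move=> qq; rewrite -s'E -exprM; apply: ler_weXn2l; first exact: ltW.
  by apply: leq_trans (ltnW qq) qQ.
have A0 : 0 < C * s ^+ m by rewrite mulr_gt0 ?exprn_gt0.
have hA m' (y : R[i]%C) : (m' < q)%N -> cabs y = 1 ->
    \prod_(0 <= j < m') cabs (y - cis (j%:R * al)) <= C * s ^+ m.
  move=> m'q y1; apply: le_trans (hC _ aleta _ _ y1) _.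
  by rewrite ler_pM2l // sm.
apply: le_trans (prod_cabs_sub_rational_ge q0 sep s1 A0 hA m) _.
have -> : C * s ^+ 3 ^+ m = C * s ^+ m * s ^+ m * s ^+ m.
  by rewrite -exprM !mulSn mul0n addn0 !exprD !mulrA.
rewrite -[leRHS]mulrA ler_pM2l ?mulr_gt0 ?exprn_gt0 //.
have -> : s ^+ m = \prod_(1 <= i < m.+1) s by rewrite prodr_const_nat subn1.
rewrite -big_split /= big_nat [leRHS]big_nat; apply: ler_prod => i.
rewrite ltnS => /andP[i0 im]; have imR : i%:R <= m%:R :> R by rewrite ler_nat.
have i0R : 0 < i%:R :> R by rewrite ltr0n.
case: ifPn => [qi|nqi].
  apply/andP; split; first by rewrite invr_ge0 exprn_ge0 // ltW.
  apply: (@le_trans _ _ (cabs (1 - cis (i%:R * th)))); last first.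
    by rewrite ler_peMl ?cabs_ge0 // ltW.
  apply: le_trans (cabs_sub_cis_diophantine dth i0).
  apply: (@le_trans _ _ (2 * (c / m%:R ^+ 2))); last first.
    rewrite ler_pM2l // ler_pM2l // lef_pV2 ?posrE ?exprn_gt0 //.
    by rewrite ler_pXn2r ?nnegrE // ltW.
  rewrite mulrA -[leRHS]invrK lef_pV2 ?posrE ?exprn_gt0 ?invr_gt0 ?divr_gt0 ?mulr_gt0 ?exprn_gt0 //.
  rewrite invf_div; apply: le_trans (hn0 q nq).
  rewrite (_ : _ / _ = (2 * c ^+ 3)^-1 * (c * m%:R) ^+ 2); last first.
    by field; rewrite gt_eqF.
  rewrite ler_pM2l ?invr_gt0 ?mulr_gt0 ?exprn_gt0 //.
  by rewrite (exprM _ 2 2) ler_pXn2r ?nnegrE ?mulr_ge0 ?exprn_ge0 // ltW.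
rewrite cabs_ge0 /=; set d := cabs (1 - cis (i%:R * al)).
have d2 : 2 / q%:R <= d.
  rewrite /d (cis_separated_mod i q0 sep); case: sep => _; apply.
  by rewrite ltn_mod q0 andbT lt0n.
have hd : d <= cabs (1 - cis (i%:R * th)) + 8 / (T%:R * q%:R).
  apply: le_trans (cabsB _ (1 - cis (i%:R * th))) _; rewrite lerD2l.
  rewrite (_ : _ - _ - _ = cis (i%:R * th) - cis (i%:R * al)); last by ring.
  apply: le_trans (cabs_cisB_le _ _) _.
  rewrite -mulrBr normrM ger0_norm //.
  rewrite (_ : 8 / _ = 8 * (m%:R * ((T * m)%:R^-1 / q%:R))); last first.
    by rewrite natrM; field; rewrite !gt_eqF.
  by rewrite ler_pM2l // ler_pM.
have h4 : 8 / (T%:R * q%:R) <= (1 - s^-1) * d.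
  rewrite (_ : 8 / _ = 4 / T%:R * (2 / q%:R)); last first.
    by field; rewrite !gt_eqF.
  by rewrite ler_pM // divr_ge0 // ltW.
rewrite -ler_pdivrMl // ; lra.
Qed.

(** The constant absorbs the finitely many exceptional values. *)
Lemma eventually_ge1_everywhere (R : realType) (f : nat -> R) (C0 : R) (m0 : nat) :
  0 < C0 -> (forall m, 0 < f m) -> (forall m, (m0 <= m)%N -> 1 <= C0 * f m) ->
  exists2 C, 0 < C & forall m, 1 <= C * f m.
Proof.
move=> C00 f0 hf; pose S := \sum_(i < m0) (f i)^-1.
have S0 : 0 <= S by apply: sumr_ge0 => i _; rewrite invr_ge0 ltW.
exists (C0 + S) => [|m]; first by rewrite ltr_pwDl.
have [mm|mm] := leqP m0 m.
  by apply: le_trans (hf m mm) _; rewrite ler_pM2r // lerDl.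
rewrite -ler_pdivrMr // div1r.
apply: (@le_trans _ _ S); last by rewrite lerDr ltW.
rewrite /S (bigD1 (Ordinal mm)) //= lerDl.
by apply: sumr_ge0 => i _; rewrite invr_ge0 ltW.
Qed.

Lemma prod_cabs_sub_cis_ge (R : realType) (c th rho : R) :
  diophantine c th -> 1 < rho ->
  exists2 C : R, 0 < C & forall m,
    1 <= C * rho ^+ m * \prod_(1 <= i < m.+1) cabs (1 - cis (i%:R * th)).
Proof.
move=> dth rho1; have rho0 : 0 < rho by apply: lt_trans rho1.
have [C0 [m0 [C00 h]]] := prod_cabs_sub_cis_ge_eventually dth rho1.
pose f m := rho ^+ m * \prod_(1 <= i < m.+1) cabs (1 - cis (i%:R * th)).
have f0 m : 0 < f m.
  rewrite mulr_gt0 ?exprn_gt0 // big_nat prodr_gt0 // => i /andP[i0 _].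
  exact: cabs_sub_cis_gt0 dth i0.
have [|C C_gt0 hC] := @eventually_ge1_everywhere _ f C0 m0 C00 f0.
  by move=> m /h; rewrite mulrA.
by exists C => // m; rewrite -mulrA; exact: hC.
Qed.

(** * The closed form of the continuants *)

(** The continuant with entries z, z w, z w^2, ..., that is, the lower right
    entry of the product of the matrices [0, 1; 1, z w^k]. *)
Fixpoint skew_continuant (F : fieldType) (z w : F) (n : nat) : F :=
  match n with
  | 0 => 1
  | n1.+1 => match n1 with
             | 0 => z
             | n2.+1 => z * w ^+ n1 * skew_continuant z w n1 + skew_continuant z w n2
             end
  end.

(** The q-Pochhammer symbol (Q; Q)_m. *)
Definition qfact (F : fieldType) (Q : F) (m : nat) : F :=
  \prod_(1 <= i < m.+1) (1 - Q ^+ i).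

Definition continuant_coef (F : fieldType) (w : F) (j l : nat) : F :=
  w ^+ 'C(l, 2) * (qfact (w ^+ 2) (j + l) / (qfact (w ^+ 2) j * qfact (w ^+ 2) l)).

Definition continuant_term (F : fieldType) (z w : F) (n j : nat) : F :=
  if (j.*2 <= n)%N then continuant_coef w j (n - j.*2) * z ^+ (n - j.*2) else 0.

Lemma qfact0 (F : fieldType) (Q : F) : qfact Q 0 = 1.
Proof. by rewrite /qfact big_geq. Qed.

Lemma qfactS (F : fieldType) (Q : F) m : qfact Q m.+1 = qfact Q m * (1 - Q ^+ m.+1).
Proof. by rewrite /qfact big_nat_recr. Qed.

Lemma qfact_neq0 (F : fieldType) (Q : F) m :
  (forall i, (0 < i)%N -> Q ^+ i != 1) -> qfact Q m != 0.
Proof.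
move=> hQ; elim: m => [|m IH]; first by rewrite qfact0 oner_eq0.
by rewrite qfactS mulf_neq0 // subr_eq0 eq_sym hQ.
Qed.

(** After division by the common factors this is the q-Pascal rule
    1 - Q^(j+l+2) = Q^(j+1) (1 - Q^(l+1)) + (1 - Q^(j+1)) for Q = w^2. *)
Lemma continuant_coef_rec (F : fieldType) (w : F) (j l : nat) :
  (forall i, (0 < i)%N -> (w ^+ 2) ^+ i != 1) ->
  continuant_coef w j.+1 l.+1 =
  w ^+ (j.*2 + l).+2 * continuant_coef w j.+1 l + continuant_coef w j l.+1.
Proof.
move=> hw; rewrite /continuant_coef !addSn !addnS !qfactS.
have := qfact_neq0 j hw; have := qfact_neq0 l hw.
have q1 i : 1 - (w ^+ 2) ^+ i.+1 != 0 by rewrite subr_eq0 eq_sym hw.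
have := q1 j; have := q1 l.
rewrite binS bin1 exprD.
have -> : (w ^+ 2) ^+ (j + l).+2 = (w ^+ 2) ^+ j.+1 * (w ^+ 2) ^+ l.+1.
  by rewrite -exprD; congr (_ ^+ _); lia.
have -> : w ^+ (j.*2 + l).+2 = (w ^+ 2) ^+ j.+1 * w ^+ l.
  by rewrite -exprM -exprD; congr (_ ^+ _); lia.
move: ((w ^+ 2) ^+ j.+1) ((w ^+ 2) ^+ l.+1) (qfact _ j) (qfact _ l) => A B gj gl.
by move=> hB hA hl hj; field; rewrite hA hB hl hj.
Qed.

Lemma continuant_coef0 (F : fieldType) (w : F) (l : nat) :
  (forall i, (0 < i)%N -> (w ^+ 2) ^+ i != 1) ->
  continuant_coef w 0 l = w ^+ 'C(l, 2).
Proof.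
by move=> hw; rewrite /continuant_coef qfact0 mul1r divff ?mulr1 ?qfact_neq0.
Qed.

Lemma continuant_coefn0 (F : fieldType) (w : F) (j : nat) :
  (forall i, (0 < i)%N -> (w ^+ 2) ^+ i != 1) -> continuant_coef w j 0 = 1.
Proof.
by move=> hw; rewrite /continuant_coef qfact0 mulr1 addn0 divff ?qfact_neq0 // mulr1.
Qed.

Lemma continuant_term_rec (F : fieldType) (z w : F) (n j : nat) :
  (forall i, (0 < i)%N -> (w ^+ 2) ^+ i != 1) ->
  continuant_term z w n.+2 j.+1 =
  z * w ^+ n.+1 * continuant_term z w n.+1 j.+1 + continuant_term z w n j.
Proof.
move=> hw; rewrite /continuant_term doubleS !ltnS.
have [jn|jn] := leqP j.*2 n; last by rewrite ifN ?mulr0 ?addr0 // -leqNgt; lia.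
rewrite !subSS; case: (ltnP j.*2 n) => [jn'|nj].
  have [l ln] : exists l, n = (j.*2 + l.+1)%N by exists (n - j.*2).-1; lia.
  have -> : (n - j.*2 = l.+1)%N by lia.
  have -> : (n - (j.*2).+1 = l)%N by lia.
  rewrite continuant_coef_rec // ln addnS (exprS z).
  by move: (w ^+ _) (z ^+ _) => W Z; ring.
have -> : (n - j.*2 = 0)%N by lia.
by rewrite !continuant_coefn0 // mulr0 add0r.
Qed.

Lemma continuant_term_overflow (F : fieldType) (z w : F) (n j : nat) :
  (n < j.*2)%N -> continuant_term z w n j = 0.
Proof. by move=> nj; rewrite /continuant_term ifN // -ltnNge. Qed.

(** A q-analogue of the expansion of the Fibonacci polynomials.  The terms with
    2 j > n vanish, so that the range of j is harmless. *)
Lemma skew_continuantE (F : fieldType) (z w : F) (n : nat) :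
  (forall i, (0 < i)%N -> (w ^+ 2) ^+ i != 1) ->
  skew_continuant z w n = \sum_(0 <= j < n.+1) continuant_term z w n j.
Proof.
move=> hw; have t0 m : continuant_term z w m 0 = w ^+ 'C(m, 2) * z ^+ m.
  by rewrite /continuant_term continuant_coef0 // double0 subn0.
suff : skew_continuant z w n = \sum_(0 <= j < n.+1) continuant_term z w n j /\
  skew_continuant z w n.+1 = \sum_(0 <= j < n.+2) continuant_term z w n.+1 j by case.
elim: n => [|n [IH0 IH1]]; split => //.
- by rewrite big_nat1 t0 expr0 mulr1.
- by rewrite big_nat_recr //= big_nat1 t0 continuant_term_overflow // mul1r addr0.
rewrite -[LHS]/(z * w ^+ n.+1 * skew_continuant z w n.+1 + skew_continuant z w n).
rewrite {}IH1 {}IH0 [RHS]big_nat_recl //.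
under [in RHS]eq_bigr do rewrite continuant_term_rec //.
rewrite big_split /= -big_distrr /=.
rewrite [X in _ = _ + (_ + X)]big_nat_recr //=.
rewrite (@continuant_term_overflow _ _ _ n n.+1) ?addr0; last by lia.
rewrite [X in _ = _ + (_ * X + _)]big_nat_recr //=.
rewrite (@continuant_term_overflow _ _ _ n.+1 n.+2) ?addr0; last by lia.
rewrite addrA; congr (_ + _).
rewrite big_nat_recl // mulrDr; congr (_ + _).
rewrite !t0 (binS n.+1) bin1 exprD [z ^+ n.+2]exprS.
by move: (w ^+ _) (w ^+ _) (z ^+ _) => W1 W2 Z; ring.
Qed.

Lemma diophantine_double (R : realType) (c a : R) :
  diophantine c a -> diophantine (c / 4) (2 * a).
Proof.
move=> [c0 hc]; split=> [|i p i0]; first by rewrite divr_gt0.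
have i0R : 0 < i%:R :> R by rewrite ltr0n.
have := hc (2 * i)%N p; rewrite muln_gt0 i0 => /(_ isT).
rewrite natrM (_ : c / _ = c / 4 / i%:R ^+ 2); last by field; rewrite gt_eqF.
by rewrite mulrA (mulrC 2 i%:R).
Qed.

(** * Subexponential bounds for the transfer matrices *)

Lemma cabs_qfact (R : realType) (a : R) (m : nat) :
  cabs (qfact (cis a ^+ 2) m) =
  \prod_(1 <= i < m.+1) cabs (1 - cis (i%:R * (2 * a))).
Proof.
by rewrite /qfact cabs_prod; apply: eq_bigr => i _; rewrite !cis_natM.
Qed.

Lemma prod_cabs_sub_cis_le (R : realType) (c th rho : R) :
  diophantine c th -> 1 < rho ->
  exists2 C : R, 0 < C & forall m,
    \prod_(1 <= i < m.+1) cabs (1 - cis (i%:R * th)) <= C * rho ^+ m.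
Proof.
move=> dth rho1; have [C [eta [C0 eta0 hC]]] := prod_cabs_sub_le dth rho1.
exists C => // m; apply: le_trans (hC th _ m (cis (- th)) (cabs_cis _)); last first.
  by rewrite subrr normr0 ltW.
rewrite big_add1 /= le_eqVlt; apply/orP; left; apply/eqP; apply: eq_bigr => j _.
rewrite -natr1 mulrDl mul1r cisD -[RHS]mulr1 -(cabs_cis th) -cabsM mulrBl.
by rewrite [cis (- th) * _]mulrC cisN.
Qed.

Lemma linear_le_exponential (R : realType) (x : R) : 1 < x ->
  exists2 C : R, 0 < C & forall n, n.+1%:R <= C * x ^+ n.
Proof.
move=> x1; have d0 : 0 < x - 1 by rewrite subr_gt0.
have x0 : 0 < x by apply: lt_trans x1.
pose C := 1 + (x - 1)^-1; have C1 : 1 <= C by rewrite lerDl invr_ge0 ltW.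
have C0 : 0 < C by apply: lt_le_trans C1.
exists C => //; elim=> [|n IH]; first by rewrite expr0 mulr1.
have xn : 1 <= x ^+ n by rewrite exprn_ege1 // ltW.
have h1 : 1 <= C * (x - 1) by rewrite /C mulrDl mulVf ?gt_eqF // mul1r lerDr ltW.
have h2 : C * (x - 1) <= C * x ^+ n * (x - 1).
  by rewrite ler_pM2r // ler_peMr // ltW.
rewrite -natr1 exprSr mulrA; lra.
Qed.

(** A term of the closed form is bounded by one upper and two lower estimates of
    q-Pochhammer symbols, and there are n + 1 terms: four factors s^n. *)
Lemma skew_continuant_le (R : realType) (c a rho : R) :
  diophantine c a -> 1 < rho ->
  exists2 C : R, 0 < C & forall (n : nat) (z : R[i]%C), cabs z = 1 ->
    cabs (skew_continuant z (cis a) n) <= C * rho ^+ n.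
Proof.
move=> da /(@root_gt1 _ rho 4 isT)[s s1 <-].
have s0 : 0 < s by apply: lt_trans s1.
have d2 := diophantine_double da.
have [U U0 hU] := prod_cabs_sub_cis_le d2 s1.
have [L L0 hL] := prod_cabs_sub_cis_ge d2 s1.
have [E E0 hE] := linear_le_exponential s1.
set w := cis a; have w1 : cabs w = 1 by exact: cabs_cis.
have hw i : (0 < i)%N -> (w ^+ 2) ^+ i != 1.
  move=> i0; have := cabs_sub_cis_gt0 d2 i0; apply: contraTneq => h.
  by rewrite !cis_natM -/w h subrr cabs0 ltxx.
have iL m : (cabs (qfact (w ^+ 2) m))^-1 <= L * s ^+ m.
  rewrite -[leLHS]mul1r ler_pdivrMr; first by rewrite cabs_qfact.
  by rewrite lt_def cabs_ge0 cabs_eq0 qfact_neq0.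
have C0 : 0 < E * U * L * L by rewrite !mulr_gt0.
exists (E * U * L * L) => // n z z1.
rewrite skew_continuantE //; apply: le_trans (cabs_sum _ _ _) _.
have sn0 : 0 <= s ^+ n by rewrite exprn_ge0 // ltW.
have sle m : (m <= n)%N -> s ^+ m <= s ^+ n by move=> mn; rewrite ler_weXn2l // ltW.
apply: (@le_trans _ _ (\sum_(0 <= j < n.+1) U * s ^+ n * (L * s ^+ n * (L * s ^+ n)))).
  apply: ler_sum => j _; rewrite /continuant_term.
  have r0 : 0 <= U * s ^+ n * (L * s ^+ n * (L * s ^+ n)).
    by rewrite !mulr_ge0 // ltW.
  case: leqP => jn; last by rewrite cabs0.
  rewrite !cabsM !cabsX cabsV cabsM z1 w1 !expr1n mul1r mulr1 invfM.
  rewrite ler_pM ?cabs_ge0 ?mulr_ge0 ?invr_ge0 ?cabs_ge0 //.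
    rewrite cabs_qfact; apply: le_trans (hU _) _.
    by rewrite ler_pM2l // sle //; lia.
  by rewrite ler_pM ?invr_ge0 ?cabs_ge0 //; apply: le_trans (iL _) _;
    rewrite ler_pM2l // sle //; lia.
rewrite sumr_const_nat subn0 -[_ *+ n.+1]mulr_natr.
have := hE n; rewrite -exprM mulnC exprM => {}hE.
rewrite (_ : E * U * L * L * (s ^+ n) ^+ 4 =
  U * s ^+ n * (L * s ^+ n * (L * s ^+ n)) * (E * s ^+ n)); last by ring.
by rewrite ler_wpM2l // !mulr_ge0 // ltW.
Qed.

Definition transfer_prod (R : realType) (a b : R) (n : nat) : 'M[R[i]%C]_2 :=
  \prod_(0 <= k < n) transfer_mx a b k.

Lemma transfer_prodS (R : realType) (a b : R) (n : nat) (i : 'I_2) :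
  transfer_prod a b n.+1 i 0 = transfer_prod a b n i 1 /\
  transfer_prod a b n.+1 i 1 =
    transfer_prod a b n i 0 + transfer_prod a b n i 1 * cis (n%:R * a + b).
Proof.
rewrite /transfer_prod big_nat_recr //= !mxE !big_ord_recl !big_ord0 !mxE /=.
rewrite !mulr0 !mulr1 !addr0 add0r /cis.
by have -> : lift ord0 ord0 = 1 :> 'I_2 by apply: val_inj.
Qed.

Lemma cis_affine (R : realType) (a b : R) (n : nat) :
  cis (n%:R * a + b) = cis b * cis a ^+ n.
Proof. by rewrite cisD cis_natM mulrC. Qed.

Lemma transfer_prod11 (R : realType) (a b : R) (n : nat) :
  transfer_prod a b n 1 1 = skew_continuant (cis b) (cis a) n.
Proof.
suff : transfer_prod a b n 1 1 = skew_continuant (cis b) (cis a) n /\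
  transfer_prod a b n.+1 1 1 = skew_continuant (cis b) (cis a) n.+1 by case.
have P0 i j : transfer_prod a b 0 i j = (i == j)%:R.
  by rewrite /transfer_prod big_geq // mxE.
elim: n => [|n [IH0 IH1]].
  rewrite (transfer_prodS a b 0 1).2 !P0 /=; split => //.
  by rewrite cis_affine expr0 mulr1 mul1r add0r.
split => //; rewrite (transfer_prodS a b n.+1 1).2 (transfer_prodS a b n 1).1.
by rewrite IH0 IH1 cis_affine addrC mulrC.
Qed.

(** The first row starts with (1, 0) instead of (0, 1), which amounts to
    dropping the first matrix, that is, to the shift of z into z w. *)
Lemma transfer_prod01 (R : realType) (a b : R) (n : nat) :
  transfer_prod a b n.+1 0 1 = skew_continuant (cis b * cis a) (cis a) n.
Proof.
suff : transfer_prod a b n.+1 0 1 = skew_continuant (cis b * cis a) (cis a) n /\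
  transfer_prod a b n.+2 0 1 = skew_continuant (cis b * cis a) (cis a) n.+1 by case.
have P0 i j : transfer_prod a b 0 i j = (i == j)%:R.
  by rewrite /transfer_prod big_geq // mxE.
elim: n => [|n [IH0 IH1]].
  rewrite (transfer_prodS a b 1 0).2 (transfer_prodS a b 0 0).1.
  rewrite (transfer_prodS a b 0 0).2 !P0 /= mul0r addr0; split => //.
  by rewrite cis_affine expr1 mul1r add0r.
split => //; rewrite (transfer_prodS a b n.+2 0).2 (transfer_prodS a b n.+1 0).1.
by rewrite IH0 IH1 cis_affine addrC mulrC /= !exprS !mulrA.
Qed.

Lemma transfer_prod_entry_le (R : realType) (c a b rho : R) :
  diophantine c a -> 1 < rho ->
  exists2 C : R, 0 < C & forall (n : nat) (i j : 'I_2),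
    cabs (transfer_prod a b n i j) <= C * rho ^+ n.
Proof.
move=> da rho1; have [C0 C00 hC0] := skew_continuant_le da rho1.
have rho0 : 0 < rho by apply: lt_trans rho1.
have rhon n : 0 < rho ^+ n by rewrite exprn_gt0.
have ord2 (i : 'I_2) : i = 0 \/ i = 1.
  by case: i => [[|[|//]] ?]; [left|right]; apply: val_inj.
pose C := C0 + 1; have C0C : C0 <= C by rewrite /C lerDl.
have step n : C0 * rho ^+ n <= C * rho ^+ n.+1.
  rewrite exprSr mulrA; apply: (@le_trans _ _ (C * rho ^+ n)).
    by rewrite ler_pM2r.
  by rewrite ler_peMr ?ltW // mulr_gt0 // /C addr_gt0.
have P0 i j : cabs (transfer_prod a b 0 i j) <= C.
  rewrite /transfer_prod big_geq // mxE; case: (i == j).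
    by rewrite cabs1 /C lerDr ltW.
  by rewrite cabs0 /C addr_ge0 // ltW.
have w1 : cabs (cis b * cis a) = 1 by rewrite cabsM !cabs_cis mulr1.
have col1 n i : cabs (transfer_prod a b n.+1 i 1) <= C0 * rho ^+ n.+1.
  have [->|->] := ord2 i; last by rewrite transfer_prod11 hC0 // cabs_cis.
  rewrite transfer_prod01; apply: le_trans (hC0 _ _ w1) _.
  by rewrite ler_pM2l // exprS ler_peMl // ltW.
exists C => [|n i j]; first by rewrite /C addr_gt0.
case: n => [|n]; first by rewrite expr0 mulr1.
have [->|->] := ord2 j; last first.
  by apply: le_trans (col1 n i) _; rewrite ler_pM2r.
rewrite (transfer_prodS a b n i).1.
case: n => [|n]; last exact: le_trans (col1 n i) (step n.+1).
apply: le_trans (P0 _ _) _; rewrite ler_peMr ?expr1 ?ltW //.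
by rewrite /C addr_gt0.
Qed.

Lemma det2E (F : comNzRingType) (A : 'M[F]_2) :
  \det A = A 0 0 * A 1 1 - A 0 1 * A 1 0.
Proof.
rewrite (expand_det_row _ 0) !big_ord_recl big_ord0 /cofactor !det_mx11 !mxE /=.
rewrite expr0 mul1r addr0 expr1 mulN1r mulrN.
by congr (A _ _ * A _ _ - A _ _ * A _ _); apply: val_inj.
Qed.

Lemma cabs_det_transfer_prod (R : realType) (a b : R) (n : nat) :
  cabs (\det (transfer_prod a b n)) = 1.
Proof.
elim: n => [|n IH]; first by rewrite /transfer_prod big_geq // det1 cabs1.
rewrite /transfer_prod big_nat_recr //= detM cabsM [X in X * _]IH mul1r.
by rewrite det2E !mxE /= mul0r mul1r sub0r cabsN cabs1.
Qed.

(** Otherwise the determinant, of modulus 1, would have modulus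
    less than 1/4 + 1/4. *)
Lemma transfer_prod_entry_ge (R : realType) (a b : R) (n : nat) :
  exists i j : 'I_2, 1 / 2 <= cabs (transfer_prod a b n i j).
Proof.
apply: contrapT => h.
have lt i j : cabs (transfer_prod a b n i j) < 1 / 2.
  by rewrite ltNge; apply/negP => hij; apply: h; exists i, j.
have := cabs_det_transfer_prod a b n; rewrite det2E => e.
have := cabsD (transfer_prod a b n 0 0 * transfer_prod a b n 1 1)
  (- (transfer_prod a b n 0 1 * transfer_prod a b n 1 0)).
rewrite e cabsN !cabsM => {}e.
have h1 : cabs (transfer_prod a b n 0 0) * cabs (transfer_prod a b n 1 1) <= 1 / 2 * (1 / 2).
  by rewrite ler_pM ?cabs_ge0 // ltW.
have h2 : cabs (transfer_prod a b n 0 1) * cabs (transfer_prod a b n 1 0) <= 1 / 2 * (1 / 2).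
  by rewrite ler_pM ?cabs_ge0 // ltW.
lra.
Qed.

(** * Equivalence of the matrix norms *)

Lemma matrix_norm_le_entries (R : realType) (N : 'M[R[i]%C]_2 -> R) :
  is_matrix_norm N -> exists2 C : R, 0 < C &
    forall (A : 'M[R[i]%C]_2) (e : R), (forall i j, cabs (A i j) <= e) -> N A <= C * e.
Proof.
move=> [N0 _ NZ ND].
have N00 : N 0 = 0 by rewrite -(scale0r 0) NZ normr0 mul0r.
have Nsum (I : finType) (F : I -> 'M[R[i]%C]_2) : N (\sum_i F i) <= \sum_i N (F i).
  apply: (big_ind2 (fun A x => N A <= x)) => // [|A x B y Ax By]; first by rewrite N00.
  exact: le_trans (ND _ _) (lerD _ _).
pose S := \sum_(i < 2) \sum_(j < 2) N (delta_mx i j).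
have S0 : 0 <= S by apply: sumr_ge0 => i _; apply: sumr_ge0 => j _.
exists (S + 1) => [|A e hA]; first by rewrite ltr_wpDl.
have e0 : 0 <= e by apply: le_trans (hA 0 0); exact: cabs_ge0.
apply: (@le_trans _ _ (S * e)); last by rewrite ler_wpM2r // lerDl.
rewrite [A]matrix_sum_delta; apply: le_trans (Nsum _ _) _.
rewrite /S mulr_suml; apply: ler_sum => i _; apply: le_trans (Nsum _ _) _.
rewrite mulr_suml; apply: ler_sum => j _; rewrite NZ mulrC -/(cabs _).
by rewrite ler_wpM2l.
Qed.

(** Real coordinates, real parts before imaginary parts: closed bounded
    sets of real row vectors are compact. *)
Definition mx_of_coords (R : realType) (v : 'rV[R]_(2 * 2 + 2 * 2)) : 'M[R[i]%C]_2 :=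
  \matrix_(i, j) (v 0 (lshift _ (mxvec_index i j)) +i* v 0 (rshift _ (mxvec_index i j)))%C.

Definition coords_of_mx (R : realType) (A : 'M[R[i]%C]_2) : 'rV[R]_(2 * 2 + 2 * 2) :=
  row_mx (mxvec (\matrix_(i, j) complex.Re (A i j))) (mxvec (\matrix_(i, j) complex.Im (A i j))).

Lemma coords_of_mxK (R : realType) (A : 'M[R[i]%C]_2) :
  mx_of_coords (coords_of_mx A) = A.
Proof.
apply/matrixP => i j; rewrite mxE row_mxEl row_mxEr !mxvecE !mxE.
by case: (A i j).
Qed.

Lemma mx_of_coords_eq0 (R : realType) (v : 'rV[R]_(2 * 2 + 2 * 2)) :
  mx_of_coords v = 0 -> v = 0.
Proof.
move=> /matrixP v0; apply/rowP => k; rewrite mxE.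
case: (splitP k) => k' kk'.
  have -> : k = lshift _ k' by apply: val_inj.
  have [i j] := mxvec_indexP k'.
  by have := v0 i j; rewrite !mxE => /(congr1 (@complex.Re R)).
have -> : k = rshift _ k' by apply: val_inj.
have [i j] := mxvec_indexP k'.
by have := v0 i j; rewrite !mxE => /(congr1 (@complex.Im R)).
Qed.

Lemma mx_of_coordsB (R : realType) (u v : 'rV[R]_(2 * 2 + 2 * 2)) :
  mx_of_coords (u - v) = mx_of_coords u - mx_of_coords v.
Proof. by apply/matrixP => i j; rewrite !mxE. Qed.

Lemma mx_of_coordsZ (R : realType) (x : R) (v : 'rV[R]_(2 * 2 + 2 * 2)) :
  mx_of_coords (x *: v) = (x%:C)%C *: mx_of_coords v.
Proof.
by apply/matrixP => i j; rewrite !mxE /GRing.mul /= !mul0r subr0 addr0.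
Qed.

Lemma cabs_le_ReIm (R : realType) (z : R[i]%C) :
  cabs z <= `|complex.Re z| + `|complex.Im z|.
Proof.
rewrite -(@ler_pXn2r _ 2) ?nnegrE ?cabs_ge0 ?addr_ge0 // cabs_sqrE.
by rewrite sqrrD !real_normK ?num_real // addrAC lerDl mulrn_wge0 //.
Qed.

Lemma cabs_mx_of_coords (R : realType) (v : 'rV[R]_(2 * 2 + 2 * 2)) (i j : 'I_2) :
  cabs (mx_of_coords v i j) <= 2 * `|v|.
Proof.
have vk k : `|v 0 k| <= `|v|.
  have := @mx_normrE R _ _ v; rewrite -[mx_norm v]/(`|v|) => ->.
  exact: (le_bigmax _ (fun k : 'I_1 * 'I_(2 * 2 + 2 * 2) => `|v k.1 k.2|) (0, k)).
apply: le_trans (cabs_le_ReIm _) _; rewrite mxE /= mulr2n mulrDl mul1r.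
by rewrite lerD.
Qed.

(** Minimize N on the unit sphere of the real coordinate space, which is
    compact. *)
Lemma matrix_norm_ge_entries (R : realType) (N : 'M[R[i]%C]_2 -> R) :
  is_matrix_norm N -> exists2 c : R, 0 < c &
    forall (A : 'M[R[i]%C]_2) i j, c * cabs (A i j) <= N A.
Proof.
move=> hN; have [N0 NE0 NZ ND] := hN.
have [C C0 hC] := matrix_norm_le_entries hN.
pose f (v : 'rV[R]_(2 * 2 + 2 * 2)) := N (mx_of_coords v).
have NB A B : N A <= N B + N (A - B).
  by rewrite -{1}[A](subrK B) addrC; exact: ND.
have NN A : N (- A) = N A.
  by rewrite -scaleN1r NZ normrN1 mul1r.
have flip u v : `|f u - f v| <= C * 2 * `|u - v|.
  have le w : f w <= C * 2 * `|w|.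
    rewrite -mulrA; apply: hC => i j; exact: cabs_mx_of_coords.
  apply: le_trans (le (u - v)); rewrite /f mx_of_coordsB ler_norml.
  have := NB (mx_of_coords u) (mx_of_coords v).
  have := NB (mx_of_coords v) (mx_of_coords u).
  by rewrite -(NN (_ v - _)) opprB; lra.
have fcont : continuous f.
  move=> v; apply/(@cvgrPdist_le R R _ (nbhs v) (nbhs_filter v)) => e e0.
  have C2 : 0 < C * 2 by rewrite mulr_gt0.
  have idv : id u @[u --> v] --> v by exact: cvg_id.
  have /cvgrPdist_le/(_ (e / (C * 2))) := idv; rewrite divr_gt0 // => /(_ isT).
  apply: filterS => u /= uv; apply: le_trans (flip v u) _.
  by rewrite mulrC -ler_pdivlMr.
pose S : set 'rV[R]_(2 * 2 + 2 * 2) := [set v | `|v| = 1].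
have compS : compact S.
  apply: bounded_closed_compact.
    by exists 1; split; [exact: num_real|move=> x x1 v /= ->; exact: ltW].
  have -> : S = (fun v => `|v|) @^-1` [set 1 : R] by [].
  by apply: preimage_closed; [move=> v _; exact: norm_continuous|exact: closed_eq].
have scaleS (v : 'rV[R]_(2 * 2 + 2 * 2)) : v != 0 -> S (`|v|^-1 *: v).
  by move=> v0; rewrite /S /= normrZ normfV normr_id mulVf // normr_eq0.
have S0 : S !=set0.
  exists (`|const_mx 1 : 'rV[R]_(2 * 2 + 2 * 2)|^-1 *: const_mx 1); apply: scaleS.
  by apply/eqP => /rowP/(_ 0); rewrite !mxE; apply/eqP; rewrite oner_eq0.
have [v0 /set_mem v0S v0min] := @EVT_min_rV R _ f S S0 compS (continuous_subspaceT fcont).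
have m0 : 0 < f v0.
  rewrite lt_def N0 andbT; apply/eqP => /NE0/mx_of_coords_eq0 v00.
  by move: v0S; rewrite /S /= v00 normr0 => /eqP; rewrite eq_sym oner_eq0.
exists (f v0 / 2) => [|A i j]; first by rewrite divr_gt0.
pose v := coords_of_mx A; have AE : mx_of_coords v = A by exact: coords_of_mxK.
have [v0E|vn0] := eqVneq v 0.
  have := cabs_mx_of_coords v i j; rewrite AE v0E normr0 mulr0 => h.
  have -> : cabs (A i j) = 0 by apply/eqP; rewrite eq_le h cabs_ge0.
  by rewrite mulr0.
have nv : 0 < `|v| by rewrite normr_gt0.
have := v0min _ (mem_set (scaleS v vn0)).
rewrite {2}/f mx_of_coordsZ AE NZ normc_def /=.
rewrite expr0n addr0 sqrtr_sqr normfV normr_id ler_pdivlMl // mulrC.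
apply: le_trans; rewrite mulrAC ler_pdivrMr // -mulrA ler_pM2l // mulrC.
by rewrite -AE; exact: cabs_mx_of_coords.
Qed.

(** * Almost every number is Diophantine *)

Lemma sum_inv_sqr_le (R : realType) (n : nat) :
  \sum_(0 <= i < n) (i.+1%:R ^+ 2)^-1 <= 2 :> R.
Proof.
have h m : \sum_(0 <= i < m.+1) (i.+1%:R ^+ 2)^-1 <= 2 - m.+1%:R^-1 :> R.
  elim: m => [|m IH]; first by rewrite big_nat1 expr1n invr1; lra.
  rewrite big_nat_recr //=; apply: le_trans (lerD IH (lexx _)) _.
  have m0 : 0 < m.+1%:R :> R by rewrite ltr0n.
  have m1 : 0 < m.+2%:R :> R by rewrite ltr0n.
  rewrite -addrA lerD2l addrC lerBlDl -lerBlDr opprK -[leLHS]addrC.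
  have e : m.+2%:R = m.+1%:R + 1 :> R by rewrite natr1.
  rewrite (_ : _ + _ = (m.+2%:R + 1) / m.+2%:R ^+ 2); last by field; rewrite gt_eqF.
  rewrite ler_pdivrMr ?exprn_gt0 // ler_pdivlMl // e; nra.
case: n => [|n]; first by rewrite big_nil.
by apply: le_trans (h n) _; rewrite gerBl invr_ge0.
Qed.

(** The center is p / i.+1, where p = k - K.+1 * i.+1; in the union below, p runs
    through the integers with |p / i.+1| <= K + 1. *)
Definition resonant_arc (R : realType) (K : nat) (d : R) (i k : nat) : set R :=
  ball ((k%:R - (K.+1 * i.+1)%:R) / i.+1%:R : R) (d / i.+1%:R ^+ 3).

Definition resonant_level (R : realType) (K : nat) (d : R) (i : nat) : set R :=
  \big[setU/set0]_(k < (K.+1 * i.+1).*2.+1) resonant_arc K d i k.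

Definition resonant (R : realType) (K : nat) (d : R) : set R :=
  \bigcup_i resonant_level K d i.

Lemma measurable_resonant_level (R : realType) (K : nat) (d : R) (i : nat) :
  measurable (resonant_level K d i).
Proof. by apply: bigsetU_measurable => k _; exact: measurable_realfun.measurable_ball. Qed.

Lemma measurable_resonant (R : realType) (K : nat) (d : R) :
  measurable (resonant K d).
Proof. by apply: bigcup_measurable => i _; exact: measurable_resonant_level. Qed.

Lemma measure_resonant_level (R : realType) (K : nat) (d : R) (i : nat) : 0 <= d ->
  (@lebesgue_measure R (resonant_level K d i)
     <= (d * (K.*2.+3).*2%:R * (i.+1%:R ^+ 2)^-1)%:E)%E.
Proof.
move=> d0; have i0 : 0 < i.+1%:R :> R by rewrite ltr0n.
have r0 : 0 <= d / i.+1%:R ^+ 3 by rewrite divr_ge0 ?exprn_ge0.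
apply: le_trans (@Boole_inequality _ _ _ (@lebesgue_measure R) (resonant_arc K d i) _ _) _.
  by move=> k _; exact: measurable_realfun.measurable_ball.
rewrite (eq_bigr (fun=> ((d / i.+1%:R ^+ 3) *+ 2)%:E)); last first.
  by move=> k _; exact: lebesgue_measure_ball.
rewrite sumEFin lee_fin sumr_const card_ord -mulrnA -[leLHS]mulr_natr.
rewrite [leRHS](_ : _ = d / i.+1%:R ^+ 3 * (i.+1%:R * (K.*2.+3).*2%:R)); last first.
  by field; rewrite gt_eqF.
rewrite ler_wpM2l // -natrM ler_nat; nia.
Qed.

Lemma measure_resonant (R : realType) (K : nat) (d : R) : 0 <= d ->
  (@lebesgue_measure R (resonant K d) <= (d * (K.*2.+3).*2%:R * 2)%:E)%E.
Proof.
move=> d0.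
apply: le_trans (generalized_Boole_inequality _ _ _) _.
- by move=> i; exact: measurable_resonant_level.
- exact: measurable_resonant.
apply: le_trans (lee_nneseries _ (fun i _ => measure_resonant_level K i d0)) _ => //.
apply: lime_le.
  apply: is_cvg_nneseries => i _ _; rewrite lee_fin.
  by rewrite !mulr_ge0 ?invr_ge0 ?exprn_ge0.
apply: nearW => n; rewrite sumEFin lee_fin -mulr_sumr.
by rewrite ler_wpM2l ?mulr_ge0 // sum_inv_sqr_le.
Qed.

Lemma not_diophantine_resonant (R : realType) (K : nat) (d a : R) :
  0 < d <= 1 -> `|a| <= K%:R -> ~ diophantine d a -> resonant K d a.
Proof.
move=> /andP[d0 d1] aK nd.
have [i [p hip]] : exists (i : nat) (p : int), `|i.+1%:R * a - p%:~R| < d / i.+1%:R ^+ 2.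
  apply: contrapT => h; apply: nd; split=> // -[//|i] p _.
  by rewrite leNgt; apply/negP => hip; apply: h; exists i, p.
have i0 : 0 < i.+1%:R :> R by rewrite ltr0n.
pose L := (K.+1 * i.+1)%N.
have pL : `|p| <= L%:Z.
  rewrite -(ler_int R) intr_norm /=.
  have h1 : `|p%:~R| <= `|i.+1%:R * a| + `|i.+1%:R * a - p%:~R| :> R.
    rewrite -{1}[p%:~R](subKr (i.+1%:R * a)); exact: ler_normB.
  apply: le_trans h1 _; rewrite normrM (gtr0_norm i0).
  have h2 : i.+1%:R * `|a| <= i.+1%:R * K%:R by rewrite ler_pM2l.
  have h3 : d / i.+1%:R ^+ 2 <= 1.
    by rewrite ler_pdivrMr ?exprn_gt0 // mul1r (le_trans d1) // exprn_ege1 // ler1n.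
  have h4 : 1 <= i.+1%:R :> R by rewrite ler1n.
  rewrite (_ : L%:~R = (K%:R + 1) * i.+1%:R :> R); last by rewrite natr1 -natrM.
  have h5 := le_trans (ltW (lt_le_trans hip h3)) h4.
  by rewrite mulrDl mul1r lerD // [leRHS]mulrC.
have [k kE] : exists k : nat, k%:Z = p + L%:Z.
  by exists `|(p + L%:Z)%R|%N; move: pL; lia.
exists i => //; rewrite /resonant_level -bigcup_mkord; exists k => /=.
  by move: pL; rewrite -/L; lia.
have kER : k%:R - L%:R = p%:~R :> R.
  by apply/eqP; rewrite subr_eq; apply/eqP; rewrite -[k%:R]/(k%:Z%:~R) kE rmorphD.
rewrite /resonant_arc -/L kER /ball /= distrC.
rewrite -(ltr_pM2l i0) -{1}(gtr0_norm i0) -normrM mulrBr mulrCA divff ?gt_eqF // mulr1.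
by rewrite (_ : _ * (d / _) = d / i.+1%:R ^+ 2) //; field; rewrite gt_eqF.
Qed.

(** The numbers of [-K, K] that are not Diophantine lie in resonant K d for all
    small d, and the measure of this set is O(d): at denominator i there are
    O(K i) arcs of length O(d / i^3). *)
Lemma ae_diophantine (R : realType) :
  {ae @lebesgue_measure R, forall a, exists c, diophantine c a}.
Proof.
pose D (K : nat) : R := (K.*2.+3).*2%:R * 2.
have D0 K : 0 < D K by rewrite mulr_gt0 // ltr0n.
suff [A [mA A0 sub]] : (@lebesgue_measure R).-negligible
    (\bigcup_K \bigcap_n resonant K (n.+1%:R^-1 : R)).
  exists A; split=> // a /= nd; apply: sub.
  have := archi_boundP (normr_ge0 a) => /ltW aK.
  exists (Num.bound `|a|) => // n _; apply: not_diophantine_resonant => //.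
    by rewrite invr_gt0 ltr0n invf_le1 ?ltr0n // ler1n.
  by move=> dn; apply: nd; eexists; exact: dn.
apply: negligible_bigcup => K.
have mG : measurable (\bigcap_n resonant K (n.+1%:R^-1 : R)).
  by apply: bigcapT_measurable => n; exact: measurable_resonant.
apply/negligibleP => //; apply/eqP; rewrite eq_le measure_ge0 andbT.
apply/lee_addgt0Pr => e e0; rewrite add0e.
pose n := Num.bound (D K / e).
have nD : D K / e <= n.+1%:R.
  apply: le_trans (ltW (archi_boundP _)) _; first by rewrite divr_ge0 // ltW.
  by rewrite ler_nat.
apply: (@le_trans _ _ (@lebesgue_measure R (resonant K (n.+1%:R^-1 : R)))).
  apply: le_measure; rewrite ?inE //; first exact: measurable_resonant.
  by move=> a; apply.
apply: le_trans (measure_resonant _ _) _; first by rewrite invr_ge0.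
rewrite lee_fin -mulrA -/(D K) ler_pdivrMl ?ltr0n //.
by rewrite mulrC -ler_pdivrMl // mulrC.
Qed.

Lemma ae_fst (R : realType) (P : R -> Prop) :
  {ae @lebesgue_measure R, forall a, P a} ->
  {ae ((@lebesgue_measure R) \x (@lebesgue_measure R))%E, forall ab : R * R, P ab.1}.
Proof.
move=> [A [mA A0 sub]]; exists (A `*` setT); split.
- exact: measurableX.
- by rewrite product_measure1E // [X in (X * _)%E]A0 mul0e.
- by move=> [a b] /= nP; split => //; apply: sub.
Qed.

(** * The growth rate *)

Lemma transfer_prod_log_cvg (R : realType) (N : 'M[R[i]%C]_2 -> R) (c a b : R) :
  is_matrix_norm N -> diophantine c a ->
  (fun n : nat => n%:R^-1 * ln (N (transfer_prod a b n))) @ \oo --> (0 : R).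
Proof.
move=> hN da; apply/cvgrPdist_le => e e0.
have e2 : 0 < e / 2 by rewrite divr_gt0.
have [K K0 hK] := matrix_norm_le_entries hN.
have [k k0 hk] := matrix_norm_ge_entries hN.
have rho1 : 1 < expR (e / 2) by rewrite expR_gt1.
have [C C0 hC] := transfer_prod_entry_le b da rho1.
pose B := `|ln (K * C)| + `|ln (k / 2)|.
have B0 : 0 <= B / (e / 2) by rewrite divr_ge0 ?addr_ge0 // ltW.
exists (Num.bound (B / (e / 2))) => // n /= hn.
have Bn : B <= n%:R * (e / 2).
  rewrite -ler_pdivrMr //; apply: le_trans (ltW (archi_boundP B0)) _.
  by rewrite ler_nat.
have [->|n0] := posnP n; first by rewrite invr0 mul0r subrr normr0 ltW.
have n0R : 0 < n%:R :> R by rewrite ltr0n.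
set x := N _.
have xle : x <= K * C * expR (n%:R * (e / 2)).
  rewrite -mulrA mulrC (mulrC n%:R) expRM_natr mulrC; apply: hK => i j.
  exact: hC.
have xge : k / 2 <= x.
  have [i [j hij]] := transfer_prod_entry_ge a b n.
  apply: le_trans (hk _ i j); rewrite ler_pM2l //; lra.
have x0 : 0 < x by apply: lt_le_trans xge; rewrite divr_gt0.
have lnle : ln x <= ln (K * C) + n%:R * (e / 2).
  rewrite -[X in _ + X]expRK -lnM ?posrE ?mulr_gt0 ?expR_gt0 //.
  by rewrite ler_ln ?posrE ?mulr_gt0 ?expR_gt0.
have lnge : ln (k / 2) <= ln x by rewrite ler_ln ?posrE ?divr_gt0.
have lnx : `|ln x| <= B + n%:R * (e / 2).
  have := ler_norm (ln (K * C)); have := ler_norm (- ln (k / 2)).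
  have := normr_ge0 (ln (K * C)); have := normr_ge0 (ln (k / 2)).
  have ne : 0 <= n%:R * (e / 2) by rewrite mulr_ge0 // ltW.
  by rewrite normrN ler_norml /B; lra.
rewrite sub0r normrN normrM normfV (gtr0_norm n0R) ler_pdivrMl //; lra.
Qed.

Unset Implicit Arguments.

Theorem mainTheorem1 (R : realType) (N : 'M[R[i]%C]_2 -> R)
    (hN : is_matrix_norm N) :
  {ae ((@lebesgue_measure R) \x (@lebesgue_measure R))%E, forall ab : R * R,
    (fun n : nat =>
       n%:R^-1 * ln (N (\prod_(0 <= k < n) transfer_mx ab.1 ab.2 k)))
      @ \oo --> (0 : R)}.
Proof.
have [A [mA A0 sub]] := ae_fst (@ae_diophantine R).
exists A; split=> // -[a b] /= ncvg; apply: sub => -[c da]; apply: ncvg.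
exact: transfer_prod_log_cvg hN da.
Qed.
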